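(* Let $A$ be an $\ell_\infty$-embeddable nonunital uniform algebra. Then $A$ is universally $(\ell_\infty\setminus c)$-embeddable if and only if $K(A)=\{0\}$.
   Context: All algebras are associative and complex; $\ell_\infty$ is the $C^*$-algebra of bounded complex sequences and $c$ the subalgebra of convergent sequences. A uniform algebra is a commutative Banach algebra $A$ (not necessarily unital) with $\|a^2\|=\|a\|^2$ for all $a\in A$. An element $a$ of a Banach algebra $A$ is compact if the operator $A\to A$, $x\mapsto axa$, is compact; $K(A)$ is the set of compact elements of $A$. An $\ell_\infty$-embedding of a uniform algebra $A$ is an isometric (hence injective) algebra homomorphism $\phi\colon A\to\ell_\infty$; $A$ is $\ell_\infty$-embeddable if one exists. $A$ is universally $(\ell_\infty\setminus c)$-embeddable if there is an $\ell_\infty$-embedding $\phi$ of $A$ with $\phi(A)\cap c=\{0\}$ and every $\ell_\infty$-embedding $\phi$ of $A$ satisfies $\phi(A)\cap c=\{0\}$. *)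

(* Defs.v *)
From HB Require Import structures.
From mathcomp Require Import all_boot all_order all_algebra.
From mathcomp Require Import complex.
From mathcomp Require Import all_classical all_reals all_analysis.
Set Implicit Arguments.
Unset Strict Implicit.
Unset Printing Implicit Defensive.
Import Order.TTheory GRing.Theory Num.Theory.
Import numFieldNormedType.Exports.
Local Open Scope classical_set_scope.
Local Open Scope ring_scope.
Local Open Scope complex_scope.

Record banach_algebra {R : realType} {A : completeNormedModType R[i]}
    (mul : A -> A -> A) : Prop := BanachAlgebra {
  ba_mulA : associative mul ;
  ba_mulDl : left_distributive mul +%R ;
  ba_mulDr : right_distributive mul +%R ;
  ba_scaleAl : forall (k : R[i]) (a b : A), mul (k *: a) b = k *: mul a b ;
  ba_scaleAr : forall (k : R[i]) (a b : A), mul a (k *: b) = k *: mul a b ;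
  ba_normM : forall a b : A, `|mul a b| <= `|a| * `|b| }.

Record uniform_algebra {R : realType} {A : completeNormedModType R[i]}
    (mul : A -> A -> A) : Prop := UniformAlgebra {
  ua_banach : banach_algebra mul ;
  ua_mulC : commutative mul ;
  ua_norm_sqr : forall a : A, `|mul a a| = `|a| ^+ 2 }.

Definition unital {R : realType} {A : completeNormedModType R[i]}
    (mul : A -> A -> A) : Prop :=
  exists e : A, forall a : A, mul e a = a /\ mul a e = a.

Definition compact_operator {R : realType} {V W : normedModType R[i]}
    (T : V -> W) : Prop :=
  linear T /\ precompact (T @` [set x : V | `|x| <= 1]).

Definition compact_elements {R : realType} {A : completeNormedModType R[i]}
    (mul : A -> A -> A) : set A :=
  [set a | compact_operator (fun x : A => mul (mul a x) a)].

Definition linfty {R : realType} : set (nat -> R[i]^o) :=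
  [set x | bounded_fun x].

(* [normc] is the modulus with values in [R]; the library norm of [R[i]] takes
   its values in [R[i]]. *)
Definition linfty_norm {R : realType} (x : nat -> R[i]^o) : R :=
  sup [set ComplexField.Normc.normc (x n) | n in [set: nat]].

Definition convergent_seqs {R : realType} : set (nat -> R[i]^o) :=
  [set x | cvgn x].

(* The operations on [nat -> R[i]^o] are the pointwise ones. *)
Record linfty_embedding {R : realType} {A : completeNormedModType R[i]}
    (mul : A -> A -> A) (phi : A -> (nat -> R[i]^o)) : Prop := LinftyEmbedding {
  emb_linfty : forall a : A, linfty (phi a) ;
  emb_linear : linear phi ;
  emb_mul : forall a b : A, phi (mul a b) = phi a * phi b ;
  emb_isometric : forall a : A, (linfty_norm (phi a))%:C = `|a| }.

Definition linfty_embeddable {R : realType} {A : completeNormedModType R[i]}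
    (mul : A -> A -> A) : Prop :=
  exists phi : A -> (nat -> R[i]^o), linfty_embedding mul phi.

Definition universally_linfty_minus_c_embeddable {R : realType}
    {A : completeNormedModType R[i]} (mul : A -> A -> A) : Prop :=
  (exists phi : A -> (nat -> R[i]^o),
      linfty_embedding mul phi /\
      range phi `&` convergent_seqs = [set 0]) /\
  (forall phi : A -> (nat -> R[i]^o),
      linfty_embedding mul phi ->
      range phi `&` convergent_seqs = [set 0]).

(* Main.v *)
Require Import Defs.
From HB Require Import structures.
From mathcomp Require Import all_boot all_order all_algebra.
From mathcomp Require Import complex.
From mathcomp Require Import all_classical all_reals all_analysis.
From mathcomp Require Import zify.
Set Implicit Arguments.
Unset Strict Implicit.
Unset Printing Implicit Defensive.
Import Order.TTheory GRing.Theory Num.Theory.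
Import numFieldNormedType.Exports.
Local Open Scope classical_set_scope.
Local Open Scope ring_scope.
Local Open Scope complex_scope.

(** Write an embedding phi in coordinates phi a k.  Everything rests on two
    links between compact elements and null sequences.

    Null sequences give compact elements.  If phi a tends to 0, then
    multiplication by a * a maps the unit ball into a box
    {y : |phi y k| <= |w k|} with w tending to 0, and such boxes are compact
    ([compact_box]).  Hence, if K(A) = 0, no nonzero phi a tends to 0.  Nor can
    phi a tend to some l <> 0: putting b = a / l, the sequence phi (x - b x) is
    the product of a bounded sequence and a null sequence, so x = b x for every
    x, and A would be unital.

    Compact elements give minimal idempotents.  Let a be a nonzero compact
    element.  A normalised b = a * a maps the unit ball into a compact set K.
    The powers of b accumulate in K, and this forces the indicator of
    {k : |phi b k| = 1} to be phi e for some idempotent e <> 0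
    ([peak_idempotent]).  Idempotents below e also lie in K and are at mutual
    distance 1, so there is a minimal one, p
    ([exists_minimal_idempotent]).  Minimality makes each phi x constant on the
    support of p ([minimal_idempotent_constant]), since otherwise a peak
    idempotent of some element of p A would be strictly smaller than p.  Thus
    all coordinates in the support of p but one, say s, are redundant, and
    replacing them by 0 is still an embedding ([collapse_embedding]).  It sends
    p to the indicator of s, a nonzero convergent sequence, so A is not
    universally embeddable off c.

    This takes the place of the Riesz theory of compact operators.
    Inequalities are mostly kept in the partial order of R[i], where the norm
    of A takes its values. *)

(** * The norm of bounded sequences *)

Lemma normc_normr (R : realType) (z : R[i]) :
  (ComplexField.Normc.normc z)%:C = `|z|.
Proof. by []. Qed.

Lemma ge0_complexP (R : realType) (M : R[i]) : 0 <= M -> exists m : R, M = m%:C.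
Proof. by move=> /ger0_real/complex_realP. Qed.

Lemma linftyP (R : realType) (x : nat -> R[i]^o) :
  linfty x <-> exists M : R[i], forall k, `|x k| <= M.
Proof.
rewrite /linfty /=; split.
  case/ex_strict_bound_gt0 => M M0 xM; exists M => k.
  exact: ltW (xM k I).
case=> M xM; have PF := globally_properfilter (I : [set: nat] 0%N).
by apply/ex_bound; exists M => k _; exact: xM.
Qed.

Lemma linfty_norm_ub (R : realType) (x : nat -> R[i]^o) (k : nat) :
  linfty x -> `|x k| <= (linfty_norm x)%:C.
Proof.
move=> /linftyP[M xM]; rewrite -normc_normr lecR.
have M0 : 0 <= M by apply: le_trans (xM 0%N).
have [m Mm] := ge0_complexP M0.
apply: ub_le_sup; last by exists k.
by exists m => _ [j _ <-]; rewrite -lecR normc_normr -Mm.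
Qed.

Lemma linfty_norm_le (R : realType) (x : nat -> R[i]^o) (M : R[i]) :
  (forall k, `|x k| <= M) -> (linfty_norm x)%:C <= M.
Proof.
move=> xM; have M0 : 0 <= M by apply: le_trans (xM 0%N).
have [m Mm] := ge0_complexP M0.
rewrite Mm lecR; apply: ge_sup.
  by exists (ComplexField.Normc.normc (x 0%N)); exists 0%N.
by move=> _ [j _ <-]; rewrite -lecR normc_normr -Mm.
Qed.

(** * Cluster points and small quantities *)

Lemma compact_seq_cluster (K : numFieldType) (V : normedModType K) (C : set V)
    (u : nat -> V) :
  compact C -> (forall n, C (u n)) ->
  exists2 c, C c & forall e : K, 0 < e ->
    forall N, exists2 n, (N <= n)%N & `|c - u n| < e.
Proof.
move=> cC uC; have uoC : (u @ \oo) C by exists 0%N => // n _; exact: uC.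
have [c [Cc uc]] := cC (u @ \oo) _ uoC.
exists c => // e e0 N.
have [||_ [[n Nn <-]]] := uc (u @` [set n | (N <= n)%N]) (ball c e).
- by exists N => // n /= Nn; exists n.
- exact: nbhsx_ballx.
- by rewrite -ball_normE; exists n.
Qed.

Lemma expr_small (R : realType) (z e : R[i]) : `|z| < 1 -> 0 < e ->
  exists N, forall n, (N <= n)%N -> `|z| ^+ n < e.
Proof.
move=> z1 e0; have [m em] := ge0_complexP (ltW e0).
move: z1 e0; rewrite em -normc_normr ltcR (ltcR 0) => z1 m0.
set r := ComplexField.Normc.normc z in z1 *.
have r0 : 0 <= r by rewrite /r -lecR normc_normr normr_ge0.
have rlt1 : `|r| < 1 by rewrite ger0_norm.
have /cvgr0Pnorm_lt/(_ m m0)[N _ rN] := cvg_expr rlt1.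
exists N => n Nn; rewrite -rmorphXn ltcR.
by have := rN n Nn; rewrite ger0_norm// exprn_ge0.
Qed.

Lemma eq_dist_small (K : numFieldType) (x y : K) :
  (forall e, 0 < e -> `|x - y| <= e) -> x = y.
Proof.
move=> xy; apply/eqP; rewrite -subr_eq0 -normr_le0.
by apply/ler_addgt0Pr => e e0; rewrite add0r xy.
Qed.

(** * Limits along ultrafilters *)

Lemma normc_ge_Im (R : rcfType) (z : R[i]) : `|complex.Im z|%:C <= `|z|.
Proof.
by case: z => a b; rewrite lecR /= -sqrtr_sqr ler_wsqrtr // lerDr sqr_ge0.
Qed.

Lemma normc_le_ReDIm (R : rcfType) (z : R[i]) :
  `|z| <= (`|complex.Re z| + `|complex.Im z|)%:C.
Proof.
case: z => a b; rewrite lecR /= -[leRHS]ger0_norm ?addr_ge0// -[leRHS]sqrtr_sqr.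
rewrite ler_wsqrtr// sqrrD !real_normK ?num_real// [leRHS]addrAC lerDl.
by rewrite mulrn_wge0// mulr_ge0.
Qed.

(** An ultrafilter containing a bounded set of values converges by compactness
    of segments; for complex values this is applied to both coordinates. *)
Section Ultra.
Variables (R : realType) (T : Type) (F : set_system T).
Hypothesis FU : UltraFilter F.

Lemma ultra_real_limit (g : T -> R) (M : R) : F [set t | `|g t| <= M] ->
  exists l : R, forall e, 0 < e -> F [set t | `|g t - l| < e].
Proof.
have GP : ProperFilter (g @ F) by exact: fmap_proper_filter.
move=> FM; have FI : F (g @^-1` [set` `[- M, M]]).
  by apply: filterS FM => t gt; rewrite /= in_itv/= -ler_norml.
have [l [_ gl]] := @segment_compact R (- M) M (g @ F) _ FI.
exists l => e e0.
case: (in_ultra_setVsetC [set t | `|g t - l| < e] FU) => // FN.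
have FgN : F (g @^-1` (g @` ~` [set t | `|g t - l| < e])).
  by apply: filterS FN => t nt; exists t.
have [//||y [[t nt <-] /= lt]] :=
  gl (g @` ~` [set t | `|g t - l| < e]) (ball l e).
- exact: nbhsx_ballx.
- by case: nt; move: lt; rewrite -ball_normE /ball_/= distrC.
Qed.

Lemma ultra_complex_limit (g : T -> R[i]) (M : R[i]) :
  F [set t | `|g t| <= M] ->
  exists l : R[i], forall e, 0 < e -> F [set t | `|g t - l| < e].
Proof.
move=> FM.
have M0 : 0 <= M by have [t /=] := filter_ex FM; exact: le_trans.
have [m Mm] := ge0_complexP M0.
have [|u gu] := ultra_real_limit (g := fun t => complex.Re (g t)) (M := m).
  apply: filterS FM => t /= gM; rewrite -lecR -Mm.
  exact: le_trans (normc_ge_Re _) gM.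
have [|v gv] := ultra_real_limit (g := fun t => complex.Im (g t)) (M := m).
  apply: filterS FM => t /= gM; rewrite -lecR -Mm.
  exact: le_trans (normc_ge_Im _) gM.
exists (u +i* v) => e e0; have [d ed] := ge0_complexP (ltW e0).
move: e0; rewrite ed (ltcR 0) => d0.
have d2 : 0 < d / 2 by rewrite divr_gt0.
apply: filterS (filterI (gu _ d2) (gv _ d2)) => t /= [tu tv].
apply: le_lt_trans (normc_le_ReDIm _) _; rewrite ltcR.
case: (g t) tu tv => a b /= tu tv; rewrite (splitr d); exact: ltrD.
Qed.
End Ultra.

(** * Coordinates of an embedded algebra *)

Section Embedding.
Variables (R : realType) (A : completeNormedModType R[i]) (mul : A -> A -> A).
Variable phi : A -> (nat -> R[i]^o).
Hypothesis hphi : linfty_embedding mul phi.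

Lemma embD a b k : phi (a + b) k = phi a k + phi b k.
Proof. by have := emb_linear hphi 1 a b; rewrite !scale1r => ->. Qed.

Lemma emb0 k : phi 0 k = 0.
Proof. by apply: (addrI (phi 0 k)); rewrite -embD !addr0. Qed.

Lemma embZ z a k : phi (z *: a) k = z * phi a k.
Proof.
have := emb_linear hphi z a 0; rewrite !addr0 => ->.
by rewrite /= !fctE /= emb0 addr0.
Qed.

Lemma embB a b k : phi (a - b) k = phi a k - phi b k.
Proof. by rewrite -[- b]scaleN1r embD embZ mulN1r. Qed.

Lemma embM a b k : phi (mul a b) k = phi a k * phi b k.
Proof. by rewrite (emb_mul hphi). Qed.

Lemma emb_coord_le a k : `|phi a k| <= `|a|.
Proof.
by rewrite -(emb_isometric hphi); exact/linfty_norm_ub/(emb_linfty hphi).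
Qed.

Lemma norm_le_coord a M : (forall k, `|phi a k| <= M) -> `|a| <= M.
Proof. by rewrite -(emb_isometric hphi); exact: linfty_norm_le. Qed.

Lemma emb_inj a b : (forall k, phi a k = phi b k) -> a = b.
Proof.
move=> ab; apply/eqP; rewrite -subr_eq0 -normr_le0; apply: norm_le_coord => k.
by rewrite embB ab subrr normr0.
Qed.

(** A box tapering to 0 is compact: an ultrafilter on it converges in each
    coordinate, and uniformly so, because only finitely many coordinates of the
    box have size more than a given e.  It is therefore Cauchy, and completeness
    of A yields the limit. *)
Lemma compact_box (w : nat -> R[i]^o) : w @ \oo --> 0 ->
  compact [set y | forall k, `|phi y k| <= `|w k|].
Proof.
move=> /cvgr0Pnorm_lt w0; rewrite compact_ultra => F FU FB.
have /choice[l hl] : forall k, exists l : R[i],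
    forall e, 0 < e -> F [set y | `|phi y k - l| < e].
  move=> k.
  apply: (ultra_complex_limit FU (g := fun y => phi y k) (M := `|w k|)).
  by apply: filterS FB => y; exact.
have lN N e : 0 < e -> F [set y | forall k, (k < N)%N -> `|phi y k - l k| < e].
  move=> e0; elim: N => [|N IH]; first by apply: filterS filterT.
  apply: filterS (filterI IH (hl N e e0)) => y [yN yl] k.
  by rewrite ltnS leq_eqVlt => /predU1P[->//|]; exact: yN.
have Fc : cauchy F.
  apply/cauchyP => e e0; have e4 : 0 < e / 2 / 2 by rewrite !divr_gt0.
  have [N _ wN] := w0 _ e4.
  (* Finitely many coordinates are controlled by the limits l, the tail by w. *)
  pose G := [set y | forall k, (k < N)%N -> `|phi y k - l k| < e / 2 / 2] `&`
            [set y | forall k, `|phi y k| <= `|w k|].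
  have FG : F G by apply: filterI => //; exact: lN.
  have [x [xl xw]] := filter_ex FG; exists x.
  apply: filterS FG => y [yl yw]; rewrite -ball_normE /ball_/=.
  apply: (@le_lt_trans _ _ (e / 2 / 2 + e / 2 / 2)); last first.
    by rewrite -splitr [ltRHS]splitr ltrDl divr_gt0.
  apply: norm_le_coord => k; rewrite embB; have [kN|Nk] := ltnP k N.
    rewrite -(subrKA (l k)); apply: le_trans (ler_normD _ _) _.
    by apply: lerD; apply: ltW; rewrite ?(distrC (l k)); [exact: xl|exact: yl].
  apply: le_trans (ler_normB _ _) _; have /ltW wk := wN k Nk.
  by apply: lerD; [exact: le_trans (xw k) _|exact: le_trans (yw k) _].
have Fl : F --> lim F by apply: cauchy_cvg.
exists (lim F); split => //.
move=> k; apply/ler_addgt0Pr => e e0.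
have Fe : F (ball (lim F) e) by apply: Fl; exact: nbhsx_ballx.
have [y [yw]] := filter_ex (filterI FB Fe).
rewrite -ball_normE /ball_/= => /ltW ye.
rewrite -[phi _ k](subrK (phi y k)) -embB addrC.
apply: le_trans (ler_normD _ _) _.
by apply: lerD => //; exact: le_trans (emb_coord_le _ _) ye.
Qed.


Hypothesis hA : uniform_algebra mul.

Lemma null_compact_element a : phi a @ \oo --> 0 -> compact_elements mul a.
Proof.
move=> a0; split.
  move=> z x y; apply: emb_inj => k.
  by rewrite !(embM, embD, embZ) mulrDr mulrDl mulrCA !mulrA.
have w0 : (phi a \* phi a) @ \oo --> (0 : R[i]^o).
  by rewrite -(mulr0 0); exact: cvgM.
have Bc := compact_precompact (@norm_hausdorff _ A) (compact_box w0).
apply: precompact_subset Bc => _ [x /= x1 <-] k.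
rewrite /= !embM !normrM mulrAC ler_piMr ?mulr_ge0//.
exact: le_trans (emb_coord_le _ _) x1.
Qed.

(** * Peak idempotents *)

(** This is the power of exponent [n.+1]: an algebra without unit has no power
    of exponent 0. *)
Definition powS x n := iter n (mul x) x.

Lemma emb_powS x n k : phi (powS x n) k = phi x k ^+ n.+1.
Proof. by elim: n => [|n IH] /=; rewrite ?expr1// embM IH -exprS. Qed.

Lemma norm_mul_le1 x y : `|x| <= 1 -> `|y| <= 1 -> `|mul x y| <= 1.
Proof.
move=> x1 y1; apply: le_trans (ba_normM (ua_banach hA) x y) _.
by rewrite mulr_ile1.
Qed.

Lemma norm_powS_le1 x n : `|x| <= 1 -> `|powS x n| <= 1.
Proof. by move=> x1; elim: n => //= n IH; exact: norm_mul_le1. Qed.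

(** Exponents [2 ^ n] are used because the norm of a square is the square of
    the norm, so these powers keep norm 1. *)
Lemma norm_powS_exp2 x n : `|x| = 1 -> `|powS x (2 ^ n).-1| = 1.
Proof.
move=> x1; elim: n => // n IH.
suff -> : powS x (2 ^ n.+1).-1 = mul (powS x (2 ^ n).-1) (powS x (2 ^ n).-1).
  by rewrite (ua_norm_sqr hA) IH expr1n.
apply: emb_inj => k; rewrite embM !emb_powS -exprD !prednK ?expn_gt0//.
by rewrite addnn -mul2n expnS.
Qed.

(** Compactness of an element is handled through a fixed compact set K that
    contains the image of the unit ball under multiplication; this form is
    stable under multiplication by the ball and under norm limits, with the
    same K. *)
Definition absorbs (K : set A) x := forall y, `|y| <= 1 -> K (mul x y).

Lemma absorbsM K x y : absorbs K x -> `|y| <= 1 -> absorbs K (mul x y).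
Proof.
move=> Kx y1 z z1; rewrite -(ba_mulA (ua_banach hA)).
by apply: Kx; exact: norm_mul_le1.
Qed.

Lemma absorbs_powS K x n : absorbs K x -> `|x| <= 1 -> absorbs K (powS x n).
Proof.
by move=> Kx x1; case: n => //= n; apply: absorbsM => //; exact: norm_powS_le1.
Qed.

Lemma absorbs_closed K x : closed K ->
  (forall e, 0 < e -> exists2 x', absorbs K x' & `|x - x'| < e) -> absorbs K x.
Proof.
move=> cK Kx y y1; apply: cK => B /nbhs_ballP[e /= e0 eB].
have [x' Kx' xx'] := Kx e e0; exists (mul x' y); split; first exact: Kx'.
apply: eB; rewrite -ball_normE /ball_/=; apply: le_lt_trans xx'.
have -> : mul x y - mul x' y = mul (x - x') y.
  by apply: emb_inj => k; rewrite !(embM, embB) mulrBl.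
by apply: le_trans (ba_normM (ua_banach hA) _ _) _; rewrite ler_piMr.
Qed.

(** c is a cluster point of the powers [b ^ (2 ^ n)].  Where [|phi b k| = 1] all
    these powers have modulus 1, elsewhere they tend to 0; and c is nonzero as
    a limit of elements of norm 1. *)
Lemma unimodular_part K b : compact K -> absorbs K b -> `|b| = 1 ->
  exists c, [/\ absorbs K c, c <> 0 &
    forall k, `|phi c k| = (`|phi b k| == 1)%:R].
Proof.
move=> cK Kb b1; have b1' : `|b| <= 1 by rewrite b1.
pose u n := powS b (2 ^ n.+1).-1.
have uK n : K (u n).
  rewrite /u; have : (0 < (2 ^ n.+1).-1)%N.
    by rewrite -ltnS prednK ?expn_gt0// -[1%N]/(2 ^ 0)%N ltn_exp2l.
  by case: (_.-1) => // m _; apply: Kb; exact: norm_powS_le1.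
have [c _ cu] := compact_seq_cluster cK uK.
have phiu n k : phi (u n) k = phi b k ^+ (2 ^ n.+1).
  by rewrite emb_powS prednK ?expn_gt0.
exists c; split.
- apply: absorbs_closed; first exact: compact_closed (@norm_hausdorff _ A) cK.
  move=> e e0; have [n _ ne] := cu e e0 0%N; exists (u n) => //.
  exact: absorbs_powS.
- move=> c0; have [n _] := cu 1 ltr01 0%N.
  by rewrite c0 sub0r normrN norm_powS_exp2// ltxx.
- move=> k; have bk1 : `|phi b k| <= 1 by rewrite -b1 emb_coord_le.
  apply: eq_dist_small => e e0; case: eqP => [bk|/eqP bk].
    have [n _ /ltW ne] := cu e e0 0%N; apply: le_trans ne.
    have -> : 1%:R = `|phi (u n) k| by rewrite phiu normrX bk expr1n.
    by apply: le_trans (ler_dist_dist _ _) _; rewrite -embB emb_coord_le.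
  have {bk}bk1 : `|phi b k| < 1 by rewrite lt_neqAle bk.
  have e2 : 0 < e / 2 by rewrite divr_gt0.
  have [N hN] := expr_small bk1 e2; have [n Nn /ltW ne] := cu _ e2 N.
  rewrite subr0 normr_id -(subrK (phi (u n) k) (phi c k)) -embB (splitr e).
  apply: le_trans (ler_normD _ _) _; apply: lerD.
    by apply: le_trans ne; exact: emb_coord_le.
  rewrite phiu normrX; apply/ltW/hN; apply: leq_trans Nn _.
  by apply: ltnW; apply: ltn_trans (ltnSn n) _; exact: ltn_expl.
Qed.

(** Let T be the set where phi c has modulus 1.  Two powers c ^ n and c ^ m that
    are close, as exist in K, give [|1 - phi c k ^ (m - n)|] small uniformly on
    T, while all powers vanish off T.  So powers of c approximate the indicator
    of T uniformly, and a cluster point of them in K is the required element. *)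
Lemma modulus_idempotent K c : compact K -> absorbs K c ->
  (forall k, `|phi c k| = 0 \/ `|phi c k| = 1) ->
  exists2 e, absorbs K e & forall k, phi e k = `|phi c k|.
Proof.
move=> cK Kc c01; have c1 : `|c| <= 1.
  by apply: norm_le_coord => k; case: (c01 k) => ->; rewrite ?ler01.
have KS n : K (powS c n.+1) by apply: Kc; exact: norm_powS_le1.
have near1 e : 0 < e -> exists h,
    forall k, `|phi (powS c h.+1) k - `|phi c k| | <= e.
  move=> e0; have e2 : 0 < e / 2 by rewrite divr_gt0.
  have [d _ du] := compact_seq_cluster cK KS.
  (* The gap between the exponents is at least 2, so that the power found is
     again a proper multiple of c and thus lies in K. *)
  have [n _ /ltW dn] := du _ e2 0%N; have [m nm /ltW dm] := du _ e2 n.+2.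
  exists (m - n.+2)%N => k; rewrite emb_powS.
  have [ck|ck] := c01 k.
    by rewrite ck (normr0_eq0 ck) expr0n subr0 normr0 ltW.
  have -> : `|phi c k ^+ (m - n.+2).+2 - `|phi c k| | =
            `|phi (powS c m.+1 - powS c n.+1) k|.
    rewrite embB !emb_powS ck.
    have -> : (m.+2 = (m - n.+2).+2 + n.+2)%N by lia.
    rewrite exprD -[X in _ * X - X]mul1r mulrA -mulrBl normrM normrX ck.
    by rewrite expr1n !mulr1.
  apply: le_trans (emb_coord_le _ _) _; rewrite -(subrKA d) (splitr e).
  by apply: le_trans (ler_normD _ _) _; rewrite distrC lerD.
have z1 : `|2^-1 : R[i]| < 1.
  by rewrite ger0_norm ?invr_ge0// invf_lt1 ?ltr1n.
have /choice[h hh] : forall j, exists h,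
    forall k, `|phi (powS c h.+1) k - `|phi c k| | <= `|2^-1 : R[i]| ^+ j.
  by move=> j; apply: near1; rewrite exprn_gt0// normr_gt0 invr_eq0 pnatr_eq0.
have [e _ eu] := compact_seq_cluster cK (fun j => KS (h j)).
exists e.
  apply: absorbs_closed; first exact: compact_closed (@norm_hausdorff _ A) cK.
  move=> d d0; have [j _ jd] := eu d d0 0%N; exists (powS c (h j).+1) => //.
  exact: absorbs_powS.
move=> k; apply: eq_dist_small => d d0.
have d2 : 0 < d / 2 by rewrite divr_gt0.
have [N hN] := expr_small z1 d2; have [j Nj /ltW jd] := eu _ d2 N.
rewrite -(subrKA (phi (powS c (h j).+1) k)) (splitr d).
apply: le_trans (ler_normD _ _) _; apply: lerD.
  by rewrite -embB; apply: le_trans jd; exact: emb_coord_le.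
exact: le_trans (hh j k) (ltW (hN j Nj)).
Qed.

Lemma peak_idempotent K b : compact K -> absorbs K b -> `|b| = 1 ->
  exists e, [/\ absorbs K e, e <> 0 & forall k, phi e k = (`|phi b k| == 1)%:R].
Proof.
move=> cK Kb b1; have [c [Kc c0 ck]] := unimodular_part cK Kb b1.
have [|e Ke ek] := modulus_idempotent cK Kc.
  by move=> k; rewrite ck; case: eqP => _; [right|left].
exists e; split => //; last by move=> k; rewrite ek ck.
move=> e0; apply: c0; apply: emb_inj => k; rewrite emb0; apply: normr0_eq0.
by rewrite -ek e0 emb0.
Qed.

Lemma norm_idempotent q : mul q q = q -> q <> 0 -> `|q| = 1.
Proof.
move=> qq /eqP q0; have := ua_norm_sqr hA q; rewrite qq expr2 => /esym.
by rewrite -[RHS]mulr1 => /mulfI -> //; rewrite normr_eq0.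
Qed.

(** * Minimal idempotents *)

(** An infinite strictly decreasing chain of idempotents would stay in K, yet
    the difference of two of its terms is a nonzero idempotent, of norm 1. *)
Lemma exists_minimal_idempotent K p0 : compact K -> absorbs K p0 ->
  mul p0 p0 = p0 -> p0 <> 0 ->
  exists p, [/\ mul p p = p, p <> 0, absorbs K p &
    forall q, mul q q = q -> q <> 0 -> mul p q = q -> q = p].
Proof.
move=> cK Kp0 p0p0 p00; apply: contrapT => nomin.
pose G p := [/\ mul p p = p, p <> 0 & absorbs K p].
have /choice[nxt hnxt] : forall p, exists q,
    G p -> [/\ G q, mul p q = q & q <> p].
  move=> p; apply: contrapT => np; apply: nomin; exists p.
  have Gp : G p by apply: contrapT => nG; apply: np; exists p.
  have [pp pn0 Kp] := Gp; split => // q qq q0 pq; apply: contrapT => qp.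
  apply: np; exists q => _; split => //; split => //.
  by rewrite -pq; apply: absorbsM => //; rewrite norm_idempotent.
pose u n := iter n nxt p0.
have Gu n : G (u n) by elim: n => // n /hnxt[].
have uu n j : mul (u n) (u (n + j)%N) = u (n + j)%N.
  elim: j => [|j IH]; first by rewrite addn0; case: (Gu n).
  have [_ e _] := hnxt _ (Gu (n + j)%N).
  by rewrite addnS /= -{1}e (ba_mulA (ua_banach hA)) IH e.
have Ku n : K (u n).
  by have [nn n0 Kn] := Gu n; rewrite -nn; apply: Kn; rewrite norm_idempotent.
have [c _ cu] := compact_seq_cluster cK Ku.
have h2 : (0 : R[i]) < 1 / 2 by rewrite divr_gt0.
have [n _ cn] := cu _ h2 0%N; have [m nm cm] := cu _ h2 n.+1.
have d1 : `|u n - u m| < 1.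
  rewrite -(subrKA c) [ltRHS]splitr.
  by apply: le_lt_trans (ler_normD _ _) _; rewrite (distrC _ c) ltrD.
have nmE : mul (u n) (u m) = u m by rewrite -(subnKC (ltnW nm)) uu.
have n1mE : mul (u n.+1) (u m) = u m by rewrite -(subnKC nm) uu.
have [_ nn1 n1n] := hnxt _ (Gu n).
have [un un0 _] := Gu n; have [um _ _] := Gu m.
suff : `|u n - u m| = 1 by move=> e; rewrite e ltxx in d1.
apply: norm_idempotent; last first.
  move=> /subr0_eq unm; apply: n1n.
  by rewrite -[LHS]nn1 (ua_mulC hA) [in RHS]unm -n1mE -unm.
have cE k : phi (u n) k * phi (u m) k = phi (u m) k by rewrite -embM nmE.
have nE k : phi (u n) k * phi (u n) k = phi (u n) k by rewrite -embM un.
have mE k : phi (u m) k * phi (u m) k = phi (u m) k by rewrite -embM um.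
apply: emb_inj => k; rewrite embM !embB mulrBl !mulrBr nE mE cE.
by rewrite mulrC cE subrr subr0.
Qed.

(** The element y = p x - (phi x s) p lies below p and vanishes at s.  If it
    were nonzero, the peak idempotent of its normalisation z would be a nonzero
    idempotent below p that vanishes at s, so different from p. *)
Lemma minimal_idempotent_constant K p s : compact K -> absorbs K p ->
  mul p p = p ->
  (forall q, mul q q = q -> q <> 0 -> mul p q = q -> q = p) ->
  phi p s = 1 -> forall x k, phi p k = 1 -> phi x k = phi x s.
Proof.
move=> cK Kp pp pmin ps x k pk.
pose y := mul p x - phi x s *: p.
have yE j : phi y j = phi p j * (phi x j - phi x s).
  by rewrite embB embM embZ mulrBr [phi x s * _]mulrC.
have [y0|/eqP y0] := pselect (y = 0).
  by apply/eqP; rewrite -subr_eq0 -[_ - _]mul1r -pk -yE y0 emb0.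
exfalso; pose z := `|y|^-1 *: y.
have z1 : `|z| = 1 by rewrite normrZ normfV normr_id mulVf ?normr_eq0.
have ppk j : phi p j * phi p j = phi p j by rewrite -embM pp.
have pz : mul p z = z.
  apply: emb_inj => j.
  by rewrite embM embZ yE mulrCA [phi p j * (_ * _)]mulrA ppk.
have Kz : absorbs K z by rewrite -pz; apply: absorbsM; rewrite ?z1.
have [e [_ e0 ek]] := peak_idempotent cK Kz z1.
have ee : mul e e = e.
  by apply: emb_inj => j; rewrite embM ek; case: eqP; rewrite ?mulr1 ?mulr0.
have pe : mul p e = e.
  apply: emb_inj => j; rewrite embM ek; case: eqP; rewrite ?mulr0// mulr1 => zj.
  have zj0 : phi z j != 0 by rewrite -normr_eq0 zj oner_eq0.
  by apply: (mulIf zj0); rewrite -embM pz mul1r.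
have := ek s; rewrite (pmin _ ee e0 pe) ps embZ yE subrr !mulr0 normr0.
by rewrite eq_sym oner_eq0 => /eqP; rewrite oner_eq0.
Qed.

Definition collapse (S : pred nat) (s : nat) x k :=
  if S k && (k != s) then 0 else phi x k.

(** The coordinate s carries the same information as all of S, so the norm and
    the injectivity survive when the other coordinates of S are set to 0. *)
Lemma collapse_embedding (S : pred nat) s : S s ->
  (forall x k, S k -> phi x k = phi x s) ->
  linfty_embedding mul (collapse S s).
Proof.
move=> Ss Sc.
have le_coll x k : `|collapse S s x k| <= `|x|.
  by rewrite /collapse; case: ifP => _; rewrite ?normr0//; exact: emb_coord_le.
have linf x : linfty (collapse S s x) by apply/linftyP; exists `|x|.
split => //.
- move=> z x y; apply/funext => k; rewrite /collapse /= !fctE.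
  case: ifP => _; last by rewrite embD embZ.
  by rewrite scaler0 addr0.
- move=> x y; apply/funext => k; rewrite /collapse /= !fctE.
  by case: ifP => _; rewrite ?mulr0// embM.
- move=> x; apply/le_anti/andP; split; first exact: linfty_norm_le.
  apply: norm_le_coord => k; have [Sk|Sk] := boolP (S k).
    rewrite Sc//.
    have -> : phi x s = collapse S s x s by rewrite /collapse eqxx andbF.
    exact: linfty_norm_ub.
  have -> : phi x k = collapse S s x k by rewrite /collapse (negbTE Sk).
  exact: linfty_norm_ub.
Qed.

End Embedding.

(** By commutativity a x a = (a * a) x, so b is a * a scaled to norm 1, and K is
    scaled accordingly. *)
Lemma compact_element_absorbs (R : realType) (A : completeNormedModType R[i])
    (mul : A -> A -> A) (a : A) : uniform_algebra mul ->
  compact_elements mul a -> a <> 0 ->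
  exists K b, [/\ compact K, absorbs mul K b & `|b| = 1].
Proof.
move=> hA [_ aK] /eqP a0; set T := (X in precompact X) in aK.
pose b := mul a a; pose r := `|b|^-1.
have b0 : `|b| != 0 by rewrite (ua_norm_sqr hA) expf_neq0// normr_eq0.
exists ( *:%R r @` closure T), (r *: b); split.
- apply: continuous_compact; last by rewrite -precompactE.
  by apply: continuous_subspaceT => x; exact: scaler_continuous.
- move=> y y1; exists (mul b y); last by rewrite (ba_scaleAl (ua_banach hA)).
  apply: subset_closure; exists y => //=.
  by rewrite -(ba_mulA (ua_banach hA)) (ua_mulC hA y) (ba_mulA (ua_banach hA)).
- by rewrite normrZ normfV normr_id mulVf.
Qed.

(** * The equivalence *)

Unset Implicit Arguments.

Theorem corollary2p12 (R : realType) (A : completeNormedModType R[i])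
    (mul : A -> A -> A)
    (hA : uniform_algebra mul)
    (hnonunital : ~ unital mul)
    (hemb : linfty_embeddable mul) :
  universally_linfty_minus_c_embeddable mul <->
  compact_elements mul = [set 0].
Proof.
have [phi hphi] := hemb.
split=> [[_ huniv]|K0].
  apply/seteqP; split=> [a Ka|_ ->]; last first.
    apply: (null_compact_element hphi).
    have -> : phi 0 = cst 0 by apply/funext => k; rewrite (emb0 hphi).
    exact: cvg_cst.
  apply: contrapT => a0.
  have [K [b [cK Kb b1]]] := compact_element_absorbs hA Ka a0.
  have [e [Ke e0 ek]] := peak_idempotent hphi hA cK Kb b1.
  have ee : mul e e = e.
    apply: (emb_inj hphi) => k.
    by rewrite (embM hphi) ek; case: eqP; rewrite ?mulr1 ?mulr0.
  have [p [pp p0 Kp pmin]] := exists_minimal_idempotent hphi hA cK Ke ee e0.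
  have p01 k : phi p k = 0 \/ phi p k = 1.
    have /eqP : phi p k * (phi p k - 1) = 0.
      by rewrite mulrBr mulr1 -(embM hphi) pp subrr.
    by rewrite mulf_eq0 subr_eq0 => /orP[]/eqP; [left|right].
  have [s ps] : exists s, phi p s = 1.
    apply: contrapT => np; apply: p0; apply: (emb_inj hphi) => k.
    by rewrite (emb0 hphi); case: (p01 k) => // pk; case: np; exists k.
  have Sc x k : phi p k == 1 -> phi x k = phi x s.
    move=> /eqP.
    exact: (minimal_idempotent_constant hphi hA cK Kp pp pmin ps).
  pose S k := phi p k == 1.
  have Ss : S s by rewrite /S ps.
  have hpsi := collapse_embedding hphi Ss Sc.
  (* The collapsed embedding maps p to the indicator of s. *)
  have : (range (collapse phi S s) `&` convergent_seqs) (collapse phi S s p).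
    split; first by exists p.
    apply: (cvgP (0 : R[i]^o)); apply/cvgr0Pnorm_lt => d d0.
    exists s.+1 => // k /= sk; rewrite /collapse.
    case: ifPn => [_|]; first by rewrite normr0.
    rewrite negb_and /S; have ks : k != s by rewrite gtn_eqF.
    by rewrite ks orbF; case: (p01 k) => -> //; rewrite ?normr0// eqxx.
  rewrite (huniv _ hpsi) /= => /(congr1 (fun f => f s)).
  rewrite /collapse eqxx andbF ps => /eqP; rewrite oner_eq0 //.
suff H phi' : linfty_embedding mul phi' ->
    range phi' `&` convergent_seqs = [set 0].
  by split => //; exists phi; split => //; exact: H.
move=> {}hphi; apply/seteqP; split; last first.
  move=> _ ->; split.
    by exists 0 => //; apply/funext => k; rewrite (emb0 hphi).
  exact: is_cvg_cst.
move=> _ [[a _ <-] ac].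
have null0 x : phi' x @ \oo --> 0 -> x = 0.
  by move=> /(null_compact_element hphi); rewrite K0.
have [l al] : exists l : R[i]^o, phi' a @ \oo --> l by move/cvg_ex: ac.
have [l0|/eqP l0] := pselect (l = 0).
  rewrite (null0 a) -?l0//; apply/funext => k; exact: (emb0 hphi).
(* If the limit l is nonzero, then a / l is a unit. *)
exfalso; apply: hnonunital; exists (l^-1 *: a).
suff H x : mul (l^-1 *: a) x = x by move=> x; rewrite [mul x _](ua_mulC hA) H.
apply/esym/subr0_eq/null0.
have -> : phi' (x - mul (l^-1 *: a) x) =
    (fun k => (phi' x k : R[i]^o) * (1 - l^-1 * phi' a k)).
  apply/funext => k; rewrite (embB hphi) (embM hphi) (embZ hphi).
  by rewrite mulrBr mulr1 [_ * phi' x k]mulrC.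
apply/cvgr0Pnorm_lt => e e0.
(* Adding 1 to the norm of x keeps the denominator positive when x = 0. *)
have d0 : 0 < e * `|l| / (`|x| + 1).
  by rewrite divr_gt0 ?mulr_gt0 ?normr_gt0// ltr_wpDl.
move/cvgrPdist_lt/(_ _ d0) : al; apply: filterS => k kd.
have -> : 1 - l^-1 * phi' a k = l^-1 * (l - phi' a k) by rewrite mulrBr mulVf.
rewrite !normrM normfV.
apply: (@le_lt_trans _ _ ((`|x| + 1) * (`|l|^-1 * `|l - phi' a k|))).
  apply: ler_wpM2r; first by rewrite mulr_ge0// invr_ge0.
  by apply: le_trans (emb_coord_le hphi x k) _; rewrite lerDl.
rewrite -ltr_pdivlMl ?ltr_wpDl// -ltr_pdivlMl ?invr_gt0 ?normr_gt0// invrK.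
by rewrite mulrCA mulrC [`|l| * e]mulrC.
Qed.
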